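(* Let $k,m,n$ be positive integers with $n\ge2$, $m\leqslant n/2$, and $t(m+j)=t(n+j)$ for all $0\leqslant j\leqslant k$. Then $$k\ll\sqrt n\,(\log n)^{3/2},$$ where the implied constant is absolute.
   Context: For $n\ge1$, $t(n)$ is the rooted planar tree of $n$: $t(1)$ is the single-vertex tree; if $n=p_1^{a_1}\cdots p_s^{a_s}$ with primes $p_1<\dots<p_s$ and $a_i\ge1$, then $t(n)$ is a root with $s$ edges ordered left to right, the $i$-th edge leading to a copy of $t(a_i)$. $f\ll g$ means $|f|\le Cg$. *)

(* Defs.v *)
From mathcomp Require Import all_boot.

Set Implicit Arguments.
Unset Strict Implicit.
Unset Printing Implicit Defensive.

Inductive planar_tree : Type := Node of seq planar_tree.

(* Recursion on fuel: each exponent of n is smaller than n, so n units suffice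
   for t(n), see factor_treeE; prime_decomp n lists the pairs (p_i, a_i) with
   p_1 < ... < p_s. *)
Fixpoint factor_tree_rec (fuel n : nat) : planar_tree :=
  if fuel is fuel'.+1 then
    Node [seq factor_tree_rec fuel' pa.2 | pa <- prime_decomp n]
  else Node [::].

Definition factor_tree (n : nat) : planar_tree := factor_tree_rec n n.

Lemma factor_tree_rec_fuel k l n :
  n <= k -> n <= l -> factor_tree_rec k n = factor_tree_rec l n.
Proof.
elim: k l n => [|k IHk] [|l] n //=; rewrite ?leqn0.
- by move=> /eqP-> _.
- by move=> _ /eqP->.
have [->|n_gt0] := posnP n; first by [].
move=> le_nk le_nl; congr Node; apply/eq_in_map => -[p a].
move=> /mem_prime_decomp[p_pr a_gt0 pa_n] /=.
have lt_an : a < n.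
  by apply: leq_trans (ltn_expl a (prime_gt1 p_pr)) (dvdn_leq n_gt0 pa_n).
by apply: IHk; rewrite -ltnS; apply: leq_trans lt_an _.
Qed.

Lemma factor_treeE n :
  0 < n -> factor_tree n = Node [seq factor_tree (logn p n) | p <- primes n].
Proof.
case: n => // n _; rewrite {1}/factor_tree /= prime_decompE -map_comp.
congr Node; apply/eq_in_map => p; rewrite mem_primes => /and3P[p_pr _ _] /=.
apply: factor_tree_rec_fuel => //; rewrite -ltnS.
apply: leq_trans (ltn_expl _ (prime_gt1 p_pr)) _.
exact: dvdn_leq (pfactor_dvdnn p n.+1).
Qed.

Lemma factor_tree1 : factor_tree 1 = Node [::].
Proof. by []. Qed.

(* Main.v *)
Require Import Defs.
From mathcomp Require Import all_boot all_order all_algebra.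
From mathcomp Require Import reals exp.
From mathcomp Require Import zify ring lra.

Import Order.TTheory GRing.Theory Num.Theory.

Set Implicit Arguments.
Unset Strict Implicit.
Unset Printing Implicit Defensive.

(** The tree of [N] shows whether [N] is squarefree: all children of the root
    are then leaves. Put [D = n - m > 0] and let [p] be a prime with
    [p ^ 2] not dividing [D]. The [j <= k] with [p ^ 2 %| m + j] form a
    progression of about [l = k / p ^ 2] terms, along which every [n + j] must
    be divisible by [q ^ 2] for some prime [q <> p], [q <= sqrt (n + k)].
    Counting over [q] gives
    [l <= \sum_q (l / q ^ 2 + 1) <= 3 l / 4 + pi (sqrt (n + k))], so
    [k] is at most about [4 p ^ 2 * pi (sqrt (n + k))].
    Not every prime [p <= y] can satisfy [p ^ 2 %| D] once
    [\prod_(p <= y) p ^ 2 >= n], for which [y] of order [log n] suffices.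
    Chebyshev's bound for [pi] then gives even [k << sqrt n * log n]. *)

(** * Chebyshev's upper bounds for the primorial and for the number of primes *)

Definition primorial n := \prod_(0 <= p < n.+1 | prime p) p.

Definition prime_pi n := \sum_(0 <= p < n.+1 | prime p) 1.

Lemma prod_prime_exp_dvd (s : seq nat) (a x : nat) :
    uniq s -> (forall p, p \in s -> prime p -> p ^ a %| x) ->
  (\prod_(p <- s | prime p) p) ^ a %| x.
Proof.
move=> s_uniq dvd_x.
rewrite (big_morph (expn^~ a) (fun u v => expnMn u v a) (exp1n a)).
elim: s s_uniq dvd_x => [|p s IHs] /=; first by rewrite big_nil dvd1n.
move=> /andP[p_s s_uniq] dvd_x; rewrite big_cons.
have dvd_s: \prod_(q <- s | prime q) q ^ a %| x.
  by apply: IHs => // q q_s; apply: dvd_x; rewrite inE q_s orbT.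
case: ifP => // p_pr; rewrite Gauss_dvd ?dvd_x ?mem_head //=.
rewrite big_seq_cond; elim/big_rec: _ => [|q y /andP[q_s q_pr] co_py].
  exact: coprimen1.
rewrite coprimeMr co_py andbT coprimeXl // coprimeXr // prime_coprime //.
by rewrite dvdn_prime2 //; apply: contraNneq p_s => ->.
Qed.

(** Each such prime divides [(m.*2.+1)!] but neither [m!] nor [(m.+1)!]. *)
Lemma prod_prime_dvd_bin m :
  \prod_(m.+2 <= p < m.*2.+2 | prime p) p %| 'C(m.*2.+1, m).
Proof.
rewrite -[\prod_(_ <= _ < _ | _) _]expn1; apply: prod_prime_exp_dvd.
  exact: iota_uniq.
move=> p; rewrite mem_index_iota expn1 => /andP[lt_mp lt_p2m] p_pr.
have fact_ndvd i : i < p -> ~~ (p %| i`!).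
  elim: i => [|i IHi] lt_ip; first by rewrite dvdn1 gtn_eqF ?prime_gt1.
  rewrite factS Euclid_dvdM // negb_or IHi ?(ltnW lt_ip) // andbT.
  by rewrite gtnNdvd.
have: p %| (m.*2.+1)`!.
  by rewrite dvdn_fact // prime_gt0.
have le_m : m <= m.*2.+1 by lia.
rewrite -(bin_fact le_m) Euclid_dvdM // => /orP[//|].
by rewrite Euclid_dvdM // !(negPf (fact_ndvd _ _)) //; lia.
Qed.

(** The two middle coefficients of [(1 + 1) ^ m.*2.+1] are equal, so each is at most half of the
    total. *)
Lemma bin_odd_le m : 'C(m.*2.+1, m) <= 4 ^ m.
Proof.
have le_m : m.+1 <= m.*2.+1 by lia.
have eqC : 'C(m.*2.+1, m.+1) = 'C(m.*2.+1, m).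
  by rewrite -(bin_sub le_m); congr binomial; lia.
have: 'C(m.*2.+1, m) + 'C(m.*2.+1, m.+1) <= 2 ^ m.*2.+1.
  rewrite (expnDn 1 1).
  have lt1 : m < m.*2.+2 by lia.
  have lt2 : m.+1 < m.*2.+2 by lia.
  rewrite (bigD1 (Ordinal lt1)) // (bigD1 (Ordinal lt2)) /=; last first.
    by apply/eqP => /(congr1 val) /=; lia.
  by rewrite !exp1n !muln1 addnA leq_addr.
by rewrite eqC expnS -[in 2 ^ _]mul2n expnM (_ : 2 ^ 2 = 4) //; lia.
Qed.

Lemma primorial_cat m n : m <= n ->
  primorial n = primorial m * \prod_(m.+1 <= p < n.+1 | prime p) p.
Proof. by move=> le_mn; rewrite /primorial (big_cat_nat _ (n := m.+1)). Qed.

Lemma primorial_gt0 n : 0 < primorial n.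
Proof. by apply: prodn_cond_gt0 => p; apply: prime_gt0. Qed.

(** Erdős's induction. For [n = m.*2.+1] the primes up to [m.+1] are covered by induction and the
    others divide ['C(n, m)]; an even [n > 2] adds no prime. *)
Lemma primorial_le n : primorial n <= 4 ^ n.
Proof.
elim/ltn_ind: n => n IHn.
have [n_odd|n_even] := boolP (odd n).
  have [n1|n_gt1] : n = 1 \/ 1 < n by lia.
    by rewrite n1 /primorial big_mkcond !big_nat_recr //= big_geq.
  set m := n./2.
  have -> : n = m.*2.+1 by rewrite /m; lia.
  rewrite (@primorial_cat m.+1); last by rewrite /m; lia.
  apply: (@leq_trans (4 ^ m.+1 * 4 ^ m)); last first.
    by rewrite -expnD leq_exp2l //; lia.
  apply: leq_mul; first by apply: IHn; rewrite /m; lia.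
  apply: leq_trans (bin_odd_le m).
  by apply: dvdn_leq (prod_prime_dvd_bin m); rewrite bin_gt0; lia.
case: n n_even IHn => [|n] n_even IHn.
  by rewrite /primorial big_mkcond !big_nat_recr //= big_geq.
have [->|n_neq2] := eqVneq n.+1 2.
  by rewrite /primorial big_mkcond !big_nat_recr //= big_geq.
rewrite /primorial big_mkcond big_nat_recr //= -big_mkcond -/(primorial n).
rewrite ifF; last first.
  apply/negP => n_pr; case: (even_prime n_pr) => [n2|n_odd].
    by rewrite n2 in n_neq2.
  by rewrite n_odd in n_even.
rewrite muln1; apply: leq_trans (IHn n (leqnn _)) _.
by rewrite leq_exp2l.
Qed.

Lemma prime_pi_le n : prime_pi n <= n.
Proof.
rewrite /prime_pi big_mkcond big_nat_recl //= add0n -{2}[n]subn0 -[n - 0]muln1.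
rewrite -sum_nat_const_nat; apply: leq_sum => i _.
by case: ifP.
Qed.

(** The parameter [f] stands in for a logarithm. The primes up to [2 ^ f] are counted trivially;
    each larger one contributes a factor above [2 ^ f] to [primorial n <= 4 ^ n]. *)
Lemma mul_prime_pi_le f n : f * prime_pi n <= f * 2 ^ f + 2 * n.
Proof.
have [le_n|lt_n] := leqP n (2 ^ f).
  apply: leq_trans (leq_addr _ _); rewrite leq_mul2l.
  by rewrite (leq_trans (prime_pi_le n)) ?orbT.
have lt_n' : (2 ^ f).+1 <= n.+1 by lia.
rewrite /prime_pi (big_cat_nat (leq0n _) lt_n') /= mulnDr.
apply: leq_add; first by rewrite leq_mul2l prime_pi_le orbT.
rewrite -(leq_exp2l (m := 2)) // [2 ^ (2 * n)]expnM.
apply: leq_trans (primorial_le n); rewrite (primorial_cat (ltnW lt_n)).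
rewrite -[leqLHS]mul1n; apply: leq_mul; first exact: primorial_gt0.
rewrite expnM expn_sum big_nat_cond [leqRHS]big_nat_cond.
by apply: leq_prod => p /andP[/andP[/ltnW le_fp _] _]; rewrite expn1.
Qed.

(** * A lower bound for the primorial from the central binomial coefficient *)

Lemma sum_nat_leqb n t : \sum_(1 <= k < n.+1) (k <= t) = minn n t.
Proof.
elim: n => [|n IHn]; first by rewrite big_geq // min0n.
by rewrite big_nat_recr //= IHn; lia.
Qed.

Lemma bin_central_ge n : 2 ^ n <= 'C(n.*2, n).
Proof.
elim: n => // n IHn.
have eqC : 'C(n.*2.+1, n.+1) = 'C(n.*2.+1, n).
  have le_n : n.+1 <= n.*2.+1 by lia.
  by rewrite -(bin_sub le_n); congr binomial; lia.
rewrite doubleS binS eqC expnS mul2n -addnn.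
by apply: leq_add; apply: leq_trans IHn (leq_bin2l _ _).
Qed.

(* In Legendre's formula the carries at the powers [p ^ i <= 2n] contribute at
   most 1 each. *)
Lemma logn_bin_central p n : prime p -> logn p 'C(n.*2, n) <= trunc_log p n.*2.
Proof.
move=> p_pr; have p_gt1 := prime_gt1 p_pr.
set t := trunc_log p _.
have le_n : n <= n.*2 by lia.
have t_le : t <= n.*2.
  have [n0|n_gt0] := posnP n; first by rewrite /t n0 trunc_log0.
  apply: ltnW; apply: leq_trans (ltn_expl t p_gt1) _.
  by apply: trunc_logP => //; lia.
have /(congr1 (logn p)) := bin_fact le_n.
have -> : n.*2 - n = n by lia.
rewrite !lognM ?muln_gt0 ?fact_gt0 ?bin_gt0 //= !logn_fact // => eqL.
have sumE :
    \sum_(1 <= k < n.+1) n %/ p ^ k = \sum_(1 <= k < n.*2.+1) n %/ p ^ k.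
  have le_nS : n.+1 <= n.*2.+1 by lia.
  rewrite [RHS](big_cat_nat (ltn0Sn n) le_nS) /=.
  rewrite [X in _ + X]big_nat_cond [X in _ + X]big1 ?addn0 // => k.
  move=> /andP[/andP[lt_nk _] _]; apply: divn_small.
  exact: ltn_trans lt_nk (ltn_expl k p_gt1).
have: \sum_(1 <= k < n.*2.+1) n.*2 %/ p ^ k <=
      \sum_(1 <= k < n.*2.+1) (n %/ p ^ k + n %/ p ^ k + (k <= t)).
  apply: leq_sum => k _; have pk_gt0 : 0 < p ^ k by rewrite expn_gt0 ltnW.
  have [le_kt|lt_tk] := leqP k t.
    have := divn_eq n (p ^ k); have := ltn_pmod n pk_gt0.
    move: (n %/ _) (n %% _) => u v lt_v ->.
    rewrite -addnn -ltnS ltn_divLR //; nia.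
  rewrite divn_small // (leq_trans (trunc_log_ltn n.*2 p_gt1)) //.
  by rewrite leq_exp2l.
rewrite !big_split /= -eqL -sumE => le_sum.
by rewrite sum_nat_leqb in le_sum; lia.
Qed.

Lemma bin_centralE n :
  'C(n.*2, n) = \prod_(0 <= p < n.*2.+1 | prime p) p ^ logn p 'C(n.*2, n).
Proof.
set c := 'C(n.*2, n).
have c_gt0 : 0 < c by rewrite bin_gt0; lia.
rewrite -{1}(partnT c_gt0) (widen_partn (m := c + n.*2)) ?leq_addr //.
have le_c : n.*2.+1 <= (c + n.*2).+1 by lia.
rewrite (big_cat_nat (leq0n _) le_c) /=.
rewrite [X in _ * X]big_nat_cond [X in _ * X]big1 ?muln1.
  rewrite big_mkcond [RHS]big_mkcond; apply: eq_bigr => p _ /=.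
  by case: ifP => // p_npr; rewrite lognE p_npr.
move=> p /andP[/andP[lt_p _] _].
have [p_pr|/negPf p_npr] := boolP (prime p); last by rewrite lognE p_npr.
have := logn_bin_central n p_pr; rewrite -/c.
have -> : trunc_log p n.*2 = 0.
  by apply/eqP; rewrite trunc_log_eq0; lia.
by rewrite leqn0 => /eqP->.
Qed.

(* The primes [p > s] divide the binomial coefficient at most once. *)
Lemma bin_central_primorial n s : 0 < n -> n.*2 < s ^ 2 ->
  'C(n.*2, n) <= n.*2 ^ s * primorial n.*2.
Proof.
move=> n_gt0 lt_ns.
apply: (@leq_trans
  (\prod_(0 <= p < n.*2.+1 | prime p) (n.*2 ^ (p <= s) * p))).
  rewrite {1}bin_centralE; apply: leq_prod => p p_pr.
  have p_gt1 := prime_gt1 p_pr.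
  have le_log := logn_bin_central n p_pr.
  have [le_ps|lt_sp] := leqP p s.
    apply: (@leq_trans n.*2); last by rewrite expn1 leq_pmulr ?prime_gt0.
    apply: leq_trans (trunc_logP p_gt1 _); last by lia.
    by rewrite leq_exp2l.
  rewrite mul1n -[leqRHS]expn1 leq_exp2l //; apply: leq_trans le_log _.
  rewrite -ltnS -(ltn_exp2l _ _ p_gt1).
  apply: leq_ltn_trans (trunc_logP p_gt1 _) _; first by lia.
  by nia.
rewrite big_split leq_mul2r; apply/orP; right => /=.
rewrite -expn_sum leq_pexp2l ?double_gt0 // big_mkcond big_nat_recl //= add0n.
rewrite (leq_trans _ (geq_minr n.*2 s)) // -sum_nat_leqb big_add1 /=.
by apply: leq_sum => p _; case: ifP.
Qed.

(** For [n = 2 * 4 ^ r] the number [n.*2] is the square of [2 ^ r.+1], so the estimate only involves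
    powers of 2 besides the primorial. *)
Lemma primorial_pow4_ge r :
  2 ^ (2 * 4 ^ r) <= 2 ^ (2 * r.+1 * (2 ^ r.+1).+1) * primorial (4 ^ r.+1).
Proof.
have dbl : (2 * 4 ^ r).*2 = 4 ^ r.+1 by rewrite expnS; lia.
have lt_sq : (2 * 4 ^ r).*2 < (2 ^ r.+1).+1 ^ 2.
  rewrite dbl (_ : 4 = 2 ^ 2) // -!expnM mulnC expnM; nia.
apply: leq_trans (bin_central_ge _) _.
apply: leq_trans (bin_central_primorial _ lt_sq) _.
  by rewrite muln_gt0 expn_gt0.
by rewrite dbl (_ : 4 = 2 ^ 2) // -!expnM mulnA.
Qed.

(* For [r >= 6] the exponent [2 * 4 ^ r] exceeds the loss
   [2 * r.+1 * (2 ^ r.+1).+1] by at least [4 ^ r]. *)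
Lemma primorial_sqr_ge :
  exists c, forall e, 0 < e -> exists2 y, y <= c * e & 2 ^ e <= primorial y ^ 2.
Proof.
(* The witness will be [y = 4 ^ r.+1], which is [4 ^ 7 * 4 ^ trunc_log 4 e], at most [4 ^ 7 * e].
   The shift by 6 secures [8 * r.+1 <= 2 ^ r], already true at [r = 6] as [56 <= 64]. *)
exists (4 ^ 7) => e e_gt0.
pose r := trunc_log 4 e + 6; exists (4 ^ r.+1).
  rewrite /r -addnS addnC expnD leq_mul2l trunc_logP ?orbT //.
have le_er : e <= 4 ^ r.
  apply: ltnW; apply: leq_trans (trunc_log_ltn e (isT : 1 < 4)) _.
  by rewrite leq_exp2l // /r; lia.
apply: (@leq_trans (2 ^ (4 ^ r))); first by rewrite leq_exp2l.
apply: (@leq_trans (primorial (4 ^ r.+1))); last first.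
  by rewrite -[leqLHS]expn1 leq_pexp2l // primorial_gt0.
have pos : 0 < 2 ^ (4 ^ r) by rewrite expn_gt0.
rewrite -(leq_pmul2l pos) -expnD addnn -mul2n.
apply: leq_trans (primorial_pow4_ge r) _.
rewrite leq_mul2r leq_exp2l //; apply/orP; right.
have -> : 4 ^ r = 2 ^ r * 2 ^ r by rewrite -expnMn.
have: 8 * r.+1 <= 2 ^ r.
  rewrite /r; elim: (trunc_log 4 e) => // t IHt.
  by rewrite addSn expnS; lia.
by rewrite expnS; move: (2 ^ r) => x le_rx; nia.
Qed.

(** * Squarefreeness read off the tree *)

Definition is_leaf (t : planar_tree) := let: Node s := t in nilp s.

Definition all_children_leaves (t : planar_tree) :=
  let: Node s := t in all is_leaf s.

Lemma is_leaf_factor_tree n : 0 < n -> is_leaf (factor_tree n) = (n == 1).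
Proof.
move=> n_gt0; rewrite factor_treeE //= /nilp size_map size_eq0.
by rewrite primes_eq0 ltnNge; lia.
Qed.

(** The children of the root are the trees of the exponents, and among positive exponents only 1 has
    a leaf as its tree. *)
Lemma all_children_leaves_factor_tree n : 0 < n ->
  ~~ all_children_leaves (factor_tree n) <-> exists2 p, prime p & p ^ 2 %| n.
Proof.
move=> n_gt0; rewrite factor_treeE //= all_map; split.
  move/allPn => [p]; rewrite mem_primes => /and3P[p_pr _ p_n] /=.
  have log_gt0 : 0 < logn p n by rewrite logn_gt0 mem_primes p_pr n_gt0.
  rewrite is_leaf_factor_tree // => log_neq1; exists p => //.
  by rewrite pfactor_dvdn //; lia.
move=> [p p_pr]; rewrite pfactor_dvdn // => log_gt1; apply/allPn.
exists p => /=; first by rewrite -logn_gt0 ltnW.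
by rewrite is_leaf_factor_tree ?(ltnW log_gt1) // gtn_eqF.
Qed.

(** * Square divisors along an arithmetic progression *)

(** The map [i %/ q] is injective on the indices counted: two of them differ by a multiple of [q],
    hence cannot lie in the same block of length [q]. *)
Lemma sum_dvdn_progression q d a l : 0 < q -> coprime q d ->
  \sum_(i < l) (q %| a + d * i) <= l %/ q + 1.
Proof.
move=> q_gt0 co_qd.
have -> : \sum_(i < l) (q %| a + d * i) = #|[pred i : 'I_l | q %| a + d * i]|.
  rewrite -sum1_card [RHS]big_mkcond; apply: eq_bigr => i _.
  by rewrite inE; case: (q %| _).
rewrite addn1 -[leqRHS]card_ord.
pose f (i : 'I_l) : 'I_((l %/ q).+1) := inord (i %/ q).
have fE i : f i = i %/ q :> nat.
  by rewrite inordK // ltnS leq_div2r // ltnW.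
apply: (@leq_card_in _ _ f) => i j; rewrite !inE => dvd_i dvd_j eq_f.
wlog le_ij : i j dvd_i dvd_j eq_f / i <= j.
  by move=> th; case/orP: (leq_total i j) => le_ij; [|symmetry]; apply: th.
have: q %| d * (j - i).
  have -> : d * (j - i) = (a + d * j) - (a + d * i) by rewrite mulnBr; lia.
  exact: dvdn_sub.
rewrite Gauss_dvdr // => dvd_ij; apply: val_inj => /=.
have /(congr1 val) /= := eq_f; rewrite !fE => eq_div.
have := divn_eq i q; have := divn_eq j q; have := ltn_pmod j q_gt0.
rewrite -eq_div => lt_j eq_j eq_i.
have: j - i < q by lia.
move: dvd_ij; case: (j - i) (subnKC le_ij) => [|x] eq_ij dvd_x lt_x; first by lia.
by rewrite gtnNdvd in dvd_x.
Qed.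

(** Telescoping: the reciprocals of [j * (j - 1)] for [3 <= j <= n.+2] sum to
    [1/2 - 1/(n+2) = n/(2(n+2))]. *)
Lemma sum_divn_sqr_ge3 l n :
  2 * n.+2 * \sum_(0 <= i < n) l %/ i.+3 ^ 2 <= l * n.
Proof.
elim: n => [|n IHn]; first by rewrite big_geq ?muln0.
rewrite big_nat_recr //=.
have := leq_divM l (n.+3 ^ 2).
move: (l %/ _) IHn => x; move: (\sum_(_ <= _ < _) _) => s IHn le_x.
rewrite -(leq_pmul2l (ltn0Sn n.+1)).
have : n.+2 * (n.+3 * x) <= l by nia.
by nia.
Qed.

(** The prime 2 contributes a quarter of [l]; the odd primes, replaced by all integers from 3 on,
    contribute at most half. *)
Lemma sum_divn_sqr l n :
  4 * (\sum_(0 <= q < n.+1 | prime q) l %/ q ^ 2) <= 3 * l.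
Proof.
apply: (@leq_trans (4 * (l %/ 4 + \sum_(0 <= i < n) l %/ i.+3 ^ 2))).
  rewrite leq_mul2l /= big_mkcond.
  apply: (@leq_trans (\sum_(0 <= q < n.+3) if prime q then l %/ q ^ 2 else 0)).
    have le_n : n.+1 <= n.+3 by lia.
    by rewrite [leqRHS](big_cat_nat (leq0n _) le_n) /= leq_addr.
  do 3 rewrite big_nat_recl //.
  rewrite /= !add0n leq_add2l.
  by apply: leq_sum => i _; case: ifP.
have := sum_divn_sqr_ge3 l n; have := leq_divM l 4.
move: (l %/ 4) (\sum_(_ <= _ < _) _) => x s; nia.
Qed.

Lemma progression_sqr_divisors p a l b : prime p -> 0 < a ->
    (forall i, i < l -> a + p ^ 2 * i < b.+1 ^ 2) -> ~~ (p ^ 2 %| a) ->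
    (forall i, i < l -> exists2 q, prime q & q ^ 2 %| a + p ^ 2 * i) ->
  l <= 4 * prime_pi b.
Proof.
move=> p_pr a_gt0 lt_ab p_ndvd sqr_dvd.
pose P q := prime q && (q != p).
have: l <= \sum_(i < l) \sum_(0 <= q < b.+1 | P q) (q ^ 2 %| a + p ^ 2 * i).
  rewrite -{1}[l]card_ord -sum1_card; apply: leq_sum => i _.
  have [q q_pr dvd_q] := sqr_dvd i (ltn_ord i).
  (* All terms are congruent to [a] modulo [p ^ 2], so none is divisible by [p ^ 2]. *)
  have q_neqp : q != p.
    apply: contraNneq p_ndvd => eq_qp; rewrite eq_qp in dvd_q.
    by rewrite (dvdn_addl _ (dvdn_mulr i (dvdnn _))) in dvd_q.
  have lt_qb : q < b.+1.
    rewrite -(ltn_exp2r _ _ (isT : 0 < 2)); apply: leq_ltn_trans (lt_ab i (ltn_ord i)).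
    by apply: dvdn_leq dvd_q; lia.
  rewrite big_mkcond (bigD1_seq q) ?iota_uniq ?mem_index_iota //=.
  by rewrite /P q_pr q_neqp dvd_q.
rewrite exchange_big /= => le_l.
have: l <= \sum_(0 <= q < b.+1 | prime q) (l %/ q ^ 2 + 1).
  apply: leq_trans le_l _; rewrite big_mkcond [leqRHS]big_mkcond.
  apply: leq_sum => q _; rewrite /P; case: ifP => //= /andP[q_pr q_neqp].
  rewrite q_pr; apply: sum_dvdn_progression.
    by rewrite expn_gt0 prime_gt0.
  by rewrite coprimeXl // coprimeXr // prime_coprime // dvdn_prime2.
rewrite big_split /= -/(prime_pi b).
by have := sum_divn_sqr l b; lia.
Qed.

(** * Bounding [k] by a small prime whose square does not divide [n - m] *)

Lemma sqr_dvd_shift k m n p b : 0 < m -> m < n -> prime p ->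
    n + k < b.+1 ^ 2 -> ~~ (p ^ 2 %| n - m) ->
    (forall j, j <= k -> factor_tree (m + j) = factor_tree (n + j)) ->
  k %/ p ^ 2 <= 4 * prime_pi b.
Proof.
move=> m_gt0 lt_mn p_pr lt_b p_ndvd eq_tree.
have d_gt0 : 0 < p ^ 2 by rewrite expn_gt0 prime_gt0.
have [j0 lt_j0 dvd_j0] : exists2 j, j < p ^ 2 & p ^ 2 %| m + j.
  exists ((p ^ 2 - m %% p ^ 2) %% p ^ 2); first by rewrite ltn_mod.
  rewrite /dvdn modnDmr -modnDml subnKC ?modnn //.
  by apply: ltnW; rewrite ltn_mod.
have le_jk i : i < k %/ p ^ 2 -> j0 + p ^ 2 * i <= k.
  move=> lt_i; have : i.+1 * p ^ 2 <= k by rewrite -leq_divRL.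
  by rewrite mulSn mulnC; lia.
apply: (@progression_sqr_divisors p (n + j0)) => //; first by lia.
- by move=> i /le_jk le_i; apply: leq_ltn_trans lt_b; lia.
- have -> : n + j0 = (m + j0) + (n - m) by lia.
  by rewrite dvdn_addr.
move=> i /le_jk le_i.
rewrite -addnA; apply/all_children_leaves_factor_tree; first by lia.
rewrite -eq_tree //; apply/all_children_leaves_factor_tree; first by lia.
by exists p => //; rewrite addnA dvdn_add // dvdn_mulr.
Qed.

(** If [k %/ y ^ 2] were too large, every prime [p <= y] would have [p ^ 2 %| n - m]; then
    [primorial y ^ 2 >= n] would divide [n - m], which lies strictly between 0 and [n]. *)
Lemma tree_shift_bound k m n y b : 0 < m -> m < n -> n <= primorial y ^ 2 ->
    n + k < b.+1 ^ 2 ->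
    (forall j, j <= k -> factor_tree (m + j) = factor_tree (n + j)) ->
  k <= (4 * prime_pi b + 1) * y ^ 2.
Proof.
move=> m_gt0 lt_mn le_n lt_b eq_tree.
have [y0|y_gt0] := posnP y.
  move: le_n; rewrite y0 /primorial big_mkcond big_nat_recr // big_geq //=.
  by lia.
have [le_k|lt_k] := leqP (k %/ y ^ 2) (4 * prime_pi b).
  rewrite addn1 ltnW // -ltn_divLR ?expn_gt0 ?y_gt0 //; lia.
have: primorial y ^ 2 %| n - m.
  apply: prod_prime_exp_dvd => [|p]; first exact: iota_uniq.
  rewrite mem_index_iota => /andP[_ lt_py] p_pr.
  apply: contraLR lt_k => p_ndvd; rewrite -leqNgt.
  apply: leq_trans (sqr_dvd_shift m_gt0 lt_mn p_pr lt_b p_ndvd eq_tree).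
  by rewrite leq_div2l ?expn_gt0 ?prime_gt0 // leq_exp2r.
by move/dvdn_leq; rewrite subn_gt0 => /(_ lt_mn); lia.
Qed.

(** * Choice of parameters and the bound over the natural numbers *)

Lemma sqrtn_exists n : exists b, b ^ 2 <= n < b.+1 ^ 2.
Proof.
elim: n => [|n [b /andP[le_n lt_n]]]; first by exists 0.
have [le_b|lt_b] := leqP (b.+1 ^ 2) n.+1; last by exists b; lia.
by exists b.+1; nia.
Qed.

(** Serves the case [k > n], where [k] is at most of order [e ^ 4]: the excess [e ^ 6] in [k ^ 2] is
    absorbed by [2 ^ e <= 2 * n]. *)
Lemma expn6_le : exists d, forall e, e ^ 6 <= d * 2 ^ e.
Proof.
exists (6 ^ 6) => e.
have le_e : e <= 6 * 2 ^ (e %/ 6).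
  have := ltn_expl (e %/ 6) (isT : 1 < 2); have := divn_eq e 6.
  by have := ltn_pmod e (isT : 0 < 6); lia.
apply: (@leq_trans ((6 * 2 ^ (e %/ 6)) ^ 6)); first by rewrite leq_exp2r.
by rewrite expnMn -expnM leq_mul2l leq_exp2l // leq_divM orbT.
Qed.

Lemma prime_pi_sqrt_le n b : 0 < n -> b ^ 2 <= 2 * n ->
  exists2 v, (trunc_log 2 n).+1 * (4 * prime_pi b + 1) <= 20 * v
           & v ^ 2 <= 48 * n.
Proof.
move=> n_gt0 le_b; set e := (trunc_log 2 n).+1.
(* With [f] about a quarter of the binary length of [n], [4 ^ f] has order [sqrt n] and dominates
   the loss [f * 2 ^ f]. *)
pose f := (e + 3) %/ 4; have f_def : e <= 4 * f <= e + 3 by rewrite /f; lia.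
have le_u : (4 ^ f) ^ 2 <= 16 * n.
  rewrite (_ : 4 = 2 ^ 2) // -!expnM.
  apply: (@leq_trans (2 ^ (4 + trunc_log 2 n))).
    by rewrite leq_exp2l //; move: f_def; rewrite /e; lia.
  by rewrite expnD leq_mul2l trunc_logP.
have le_pi := mul_prime_pi_le f b.
have le_f := ltn_expl f (isT : 1 < 2).
have uE : 4 ^ f = 2 ^ f * 2 ^ f by rewrite -expnMn.
(* The 48 comes from [(u + 2 * b) ^ 2 <= 2 * u ^ 2 + 8 * b ^ 2] with [u ^ 2 <= 16 * n] and
   [b ^ 2 <= 2 * n]. *)
exists (4 ^ f + 2 * b); last by nia.
have le_fu : f * 2 ^ f <= 4 ^ f by rewrite uE leq_mul2r ltnW ?orbT.
have le_f4 : f <= 4 ^ f by apply: ltnW; apply: ltn_expl.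
case/andP: f_def => le_e _.
have : e * prime_pi b <= 4 * (f * prime_pi b).
  by rewrite mulnA leq_mul2r le_e orbT.
rewrite mulnDr muln1 mulnCA; lia.
Qed.

Lemma tree_shift_bound_nat : exists c, forall k m n, 0 < m -> m < n ->
    (forall j, j <= k -> factor_tree (m + j) = factor_tree (n + j)) ->
  k ^ 2 <= c * ((trunc_log 2 n).+1 ^ 2 * n).
Proof.
have [c0 primorial_c0] := primorial_sqr_ge; have [d exp6_d] := expn6_le.
(* The two summands serve the cases [k <= n] and [n < k]. *)
exists ((20 * c0 ^ 2) ^ 2 * 48 + (50 * c0 ^ 4) ^ 2 * (d * 2)).
move=> k m n m_gt0 lt_mn eq_tree.
have n_gt0 : 0 < n by lia.
set e := (trunc_log 2 n).+1.
have lt_ne : n < 2 ^ e by apply: trunc_log_ltn.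
have le_en : 2 ^ e <= 2 * n by rewrite expnS leq_mul2l trunc_logP.
have [y le_y le_ey] := primorial_c0 e isT.
have [b /andP[le_b lt_b]] := sqrtn_exists (n + k).
have le_ny : n <= primorial y ^ 2 by lia.
have le_k := tree_shift_bound m_gt0 lt_mn le_ny lt_b eq_tree.
have le_y2 : y ^ 2 <= c0 ^ 2 * e ^ 2 by rewrite -expnMn leq_exp2r.
have [le_kn|lt_nk] := leqP k n.
  have [||v le_v le_vn] := @prime_pi_sqrt_le n b => //; first by lia.
  have le_kv : k <= 20 * c0 ^ 2 * (e * v).
    apply: leq_trans le_k _.
    apply: (@leq_trans ((4 * prime_pi b + 1) * (c0 ^ 2 * e ^ 2))).
      by rewrite leq_mul2l le_y2 orbT.
    have -> : (4 * prime_pi b + 1) * (c0 ^ 2 * e ^ 2) =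
      c0 ^ 2 * e * (e * (4 * prime_pi b + 1)) by lia.
    have -> : 20 * c0 ^ 2 * (e * v) = c0 ^ 2 * e * (20 * v) by lia.
    by rewrite leq_mul2l le_v orbT.
  rewrite mulnDl; apply: leq_trans (leq_addr _ _).
  apply: (@leq_trans ((20 * c0 ^ 2 * (e * v)) ^ 2)); first by rewrite leq_exp2r.
  move: (20 * c0 ^ 2) => a.
  have -> : (a * (e * v)) ^ 2 = (a * e) ^ 2 * v ^ 2 by rewrite -expnMn mulnA.
  have -> : a ^ 2 * 48 * (e ^ 2 * n) = (a * e) ^ 2 * (48 * n).
    by rewrite expnMn; lia.
  by rewrite leq_mul2l le_vn orbT.
have k_gt0 : 0 < k by lia.
(* Here [b ^ 2 <= 2 * k], so the trivial bound [prime_pi b <= b] gives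
   [k ^ 2 <= 25 * (2 * k) * y ^ 4], and one factor [k] cancels. *)
have le_k50 : k <= 50 * (y ^ 2) ^ 2.
  have le_pib := prime_pi_le b.
  have b_gt0 : 0 < b by case: b lt_b {le_b le_k le_pib}; lia.
  have le_kb : k <= 5 * b * y ^ 2.
    by apply: leq_trans le_k _; rewrite leq_mul2r; lia.
  have le_kb2 : k ^ 2 <= (5 * b * y ^ 2) ^ 2 by rewrite leq_exp2r.
  rewrite -(leq_pmul2l k_gt0) mulnn; apply: leq_trans le_kb2 _.
  rewrite !expnMn; move: (y ^ 2 ^ 2) => z.
  have : b ^ 2 <= 2 * k by lia.
  move: (b ^ 2) => w le_w; nia.
rewrite mulnDl; apply: leq_trans (leq_addl _ _).
have le_k4 : k <= 50 * c0 ^ 4 * e ^ 4.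
  apply: leq_trans le_k50 _; rewrite -mulnA leq_mul2l /=.
  by rewrite -[4]/(2 * 2) !expnM -expnMn leq_exp2r.
apply: (@leq_trans ((50 * c0 ^ 4 * e ^ 4) ^ 2)); first by rewrite leq_exp2r.
move: (50 * c0 ^ 4) => a.
have -> : (a * e ^ 4) ^ 2 = (a * e) ^ 2 * e ^ 6.
  by rewrite (expnMn a (e ^ 4)) (expnMn a e) -mulnA -expnM -expnD.
have -> : a ^ 2 * (d * 2) * (e ^ 2 * n) = (a * e) ^ 2 * (d * (2 * n)).
  by rewrite expnMn; lia.
rewrite leq_mul2l (leq_trans (exp6_d e)) ?orbT //.
by rewrite leq_mul2l le_en orbT.
Qed.

(** * Passage to real logarithms *)

Local Open Scope ring_scope.

Lemma ln2_ge_half (R : realType) : 2^-1 <= ln 2 :> R.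
Proof.
have := @le_ln1Dx R (- 2^-1); have -> : 1 - 2^-1 = 2^-1 :> R by lra.
by rewrite lnV ?posrE // lerN2; apply; lra.
Qed.

Lemma trunc_log2_le_ln (R : realType) (n : nat) : (2 <= n)%N ->
  (trunc_log 2 n).+1%:R <= 4 * ln n%:R :> R.
Proof.
move=> n_ge2; have n_gt0 : (0 < n)%N by lia.
set t := trunc_log 2 n.
have t_ge1 : 1 <= t%:R :> R by rewrite ler1n trunc_log_gt0.
have: ln (2 ^+ t) <= ln n%:R :> R.
  by rewrite ler_ln ?posrE ?exprn_gt0 ?ltr0n // -natrX ler_nat trunc_logP.
rewrite lnXn // -[ln 2 *+ t]mulr_natr -natr1 => le_t.
have : 2^-1 * t%:R <= ln 2 * t%:R :> R.
  by rewrite ler_wpM2r ?ln2_ge_half ?ler0n.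
by lra.
Qed.

(** Weakens the first power of the logarithm to the stated exponent: [x >= 1/2] forces
    [sqrt x >= 1/2]. *)
Lemma le_powR_3half (R : realType) (x : R) : 2^-1 <= x -> x <= 2 * x `^ (3 / 2).
Proof.
move=> x_ge; have x_gt0 : 0 < x by lra.
have -> : 3 / 2 = 1 + 2^-1 :> R by lra.
rewrite powRD; last by rewrite (gt_eqF x_gt0) implybT.
rewrite powRr1 ?powR12_sqrt ?ltW //.
have := sqr_sqrtr (ltW x_gt0); have := sqrtr_ge0 x.
move: (Num.sqrt x) => s s_ge0 s2; have : 2^-1 <= s by nra.
nra.
Qed.

Theorem theorem11 (R : realType) :
  exists C : R, 0 < C /\
    forall k m n : nat,
      (0 < k)%N -> (0 < m)%N -> (2 <= n)%N ->
      m%:R <= n%:R / 2 :> R ->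
      (forall j : nat, (j <= k)%N ->
         factor_tree (m + j)%N = factor_tree (n + j)%N) ->
      k%:R <= C * (Num.sqrt n%:R * ln n%:R `^ (3 / 2)).
Proof.
have [c bound_c] := tree_shift_bound_nat.
(* The 8 is the 4 of [trunc_log2_le_ln] times the 2 of [le_powR_3half]; [c%:R + 1] dominates the
   square root of [c%:R]. *)
exists (8 * (c%:R + 1)); have c_ge0 : 0 <= c%:R :> R by apply: ler0n.
split=> [|k m n _ m_gt0 n_ge2 le_mn eq_tree]; first by lra.
have lt_mn : (m < n)%N.
  have n_ge2R : 2 <= n%:R :> R by rewrite ler_nat.
  by rewrite -(ltr_nat R); lra.
have le_k : k%:R ^+ 2 <= c%:R * ((trunc_log 2 n).+1%:R ^+ 2 * n%:R) :> R.
  by rewrite -!natrX -!natrM ler_nat; apply: bound_c eq_tree.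
have le_e := trunc_log2_le_ln R n_ge2.
have ln_ge : 2^-1 <= ln n%:R :> R.
  apply: le_trans (ln2_ge_half R) _.
  by rewrite ler_ln ?posrE ?ltr0n ?ler_nat //; lia.
have le_ln := le_powR_3half ln_ge.
have s_ge0 : 0 <= Num.sqrt n%:R :> R by apply: sqrtr_ge0.
have s2 : Num.sqrt n%:R ^+ 2 = n%:R :> R by rewrite sqr_sqrtr ?ler0n.
rewrite -s2 in le_k; move: le_k le_e s_ge0 le_ln {s2 ln_ge}.
have := ler0n R (trunc_log 2 n).+1.
move: (trunc_log 2 n).+1%:R (Num.sqrt _) (ln _ `^ _).
move=> e s l e_ge0 le_k le_e s_ge0 le_l.
apply: (@le_trans _ _ ((c%:R + 1) * (e * s))).
  have ces_ge0 : 0 <= (c%:R + 1) * (e * s).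
    by apply: mulr_ge0; [lra | apply: mulr_ge0].
  rewrite -ler_sqr ?nnegrE ?ler0n //.
  apply: le_trans le_k _; rewrite -exprMn [leRHS]exprMn.
  apply: ler_wpM2r; first exact: sqr_ge0.
  by nra.
have -> : 8 * (c%:R + 1) * (s * l) = (c%:R + 1) * (8 * l * s) by ring.
apply: ler_wpM2l; first by lra.
by apply: ler_wpM2r => //; lra.
Qed.
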